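(* $\operatorname{Aut}(P_{14}) \cong \mathbb{Z}_2 \times \mathbb{Z}_4$, where $P_{14}$ is the $14$-element poset with underlying set $\{a_0, a_1\} \cup \{(i, j) : i \in \mathbb{Z}_4,\ j \in \{0, 1, 2\}\}$ whose partial order is the reflexive-transitive closure of the following relations (first coordinates taken mod $4$): $(i, 0) < (i, 1)$ and $(i, 1) < (i, 2)$ for all $i \in \mathbb{Z}_4$; $(i, 0) < (i+1, 2)$ for all $i \in \mathbb{Z}_4$; and $a_k < (i, 0)$ for all $k \in \{0, 1\}$ and $i \in \mathbb{Z}_4$.
   Context: For a poset $P$, $\operatorname{Aut}(P)$ is the group of order-automorphisms of $P$ (bijections $P \to P$ that preserve the order and whose inverse preserves the order). $\mathbb{Z}_n$ denotes the cyclic group of order $n$ (the integers mod $n$). *)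

(* Defs.v *)
From HB Require Import structures.
From mathcomp Require Import all_boot all_order all_algebra all_fingroup.

Set Implicit Arguments.
Unset Strict Implicit.
Unset Printing Implicit Defensive.

Import Order.TTheory GRing.Theory.

Section PosetAut.
Local Open Scope group_scope.

Definition poset_Aut (d : Order.disp_t) (P : finPOrderType d) : {set {perm P}} :=
  [set s : {perm P}
    | [forall x, forall y, (x <= y)%O ==> (s x <= s y)%O]
    & [forall x, forall y, (x <= y)%O ==> (s^-1 x <= s^-1 y)%O]].

Lemma poset_AutP (d : Order.disp_t) (P : finPOrderType d) (s : {perm P}) :
  reflect ({homo s : x y / (x <= y)%O} /\ {homo s^-1 : x y / (x <= y)%O})
          (s \in poset_Aut P).
Proof.
rewrite inE; apply: (iffP andP) => -[h1 h2]; split.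
- by move=> x y; move/forallP/(_ x)/forallP/(_ y)/implyP: h1.
- by move=> x y; move/forallP/(_ x)/forallP/(_ y)/implyP: h2.
- by apply/forallP=> x; apply/forallP=> y; apply/implyP; apply: h1.
- by apply/forallP=> x; apply/forallP=> y; apply/implyP; apply: h2.
Qed.

Lemma poset_Aut_group_set (d : Order.disp_t) (P : finPOrderType d) :
  group_set (poset_Aut P).
Proof.
apply/group_setP; split=> [|s t /poset_AutP[s1 s2] /poset_AutP[t1 t2]].
  by apply/poset_AutP; rewrite invg1; split=> x y; rewrite !perm1.
by apply/poset_AutP; rewrite invMg; split=> x y le_xy; rewrite !permM;
  [apply/t1/s1 | apply/s2/t2].
Qed.

Canonical poset_Aut_group (d : Order.disp_t) (P : finPOrderType d) :=
  Group (poset_Aut_group_set P).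

End PosetAut.

(* [inl k] is the point a_k and [inr (i, j)] is the point (i, j). *)
Definition P14 : Type := ('I_2 + 'Z_4 * 'I_3)%type.

HB.instance Definition _ := Finite.on P14.

Definition P14_gen : rel P14 := fun x y =>
  match x, y with
  | inl _, inr (_, j) => j == 0 :> nat
  | inr (i, j), inr (i', j') =>
      [|| [&& i' == i, j == 0 :> nat & j' == 1 :> nat],
          [&& i' == i, j == 1 :> nat & j' == 2 :> nat]
        | [&& i' == (i + 1)%R, j == 0 :> nat & j' == 2 :> nat]]
  | _, inl _ => false
  end.

(* [connect] is the reflexive-transitive closure. *)
Definition P14_le : rel P14 := connect P14_gen.

Definition P14_height (x : P14) : nat :=
  if x is inr (_, j) then j.+1 else 0.

Lemma P14_le_height x y : P14_le x y -> (x == y) || (P14_height x < P14_height y).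
Proof.
case/connectP=> p; elim: p x => [|z p IHp] x /=; first by move=> _ ->; rewrite eqxx.
case/andP=> gxz pz ey.
have ltxz: P14_height x < P14_height z.
  move: gxz; case: (x) (z) => [k|[i j]] [k'|[i' j']] //=.
  by case/or3P=> /and3P[_ /eqP-> /eqP->].
case/orP: (IHp z pz ey) => [/eqP <-|ltzy]; first by rewrite ltxz orbT.
by rewrite (ltn_trans ltxz ltzy) orbT.
Qed.

Lemma P14_le_refl : reflexive P14_le.
Proof. exact: connect0. Qed.

Lemma P14_le_anti : antisymmetric P14_le.
Proof.
move=> x y /andP[/P14_le_height/orP[/eqP //|ltxy] /P14_le_height/orP[/eqP //|]].
by move/(ltn_trans ltxy); rewrite ltnn.
Qed.

Lemma P14_le_trans : transitive P14_le.
Proof. exact: connect_trans. Qed.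

Fact P14_display : Order.disp_t.
Proof. exact: Order.Disp tt tt. Qed.

HB.instance Definition _ := Order.Le_isPOrder.Build
  P14_display P14 P14_le_refl P14_le_anti P14_le_trans.

(* Main.v *)
Require Import Defs.
From mathcomp Require Import all_boot all_order all_algebra all_fingroup.

(** The group Z_2 x Z_4 acts on the poset by translations: the first factor
    swaps a_0 and a_1, the second rotates the three levels (_, 0), (_, 1),
    (_, 2) simultaneously.  Translations preserve the generating relations, so
    they are automorphisms, and the action is visibly faithful; the content is
    that there are no other automorphisms.

    Every point lies on a chain a_k < (i, 0) < (i, 1) < (i, 2), which meets all
    four heights.  An automorphism sends it to a chain of four points, again of
    heights 0 < 1 < 2 < 3, so it preserves heights ([aut_height]).  Distinct
    columns are comparable only through (i, 0) <= (i + 1, 2), so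
    (i, 0) <= (i, 1) <= (i, 2) forces the automorphism to act on the index i by
    the same map f on each level ([aut_column]).  Then (i, 0) <= (i + 1, 2)
    forces f (i + 1) to be f i or f i + 1, and injectivity excludes f i.  Hence
    f is the rotation by f 0 ([aut_rotation]), while the two minimal points are
    permuted by a translation of Z_2 ([I2_inj_translation]). *)

Set Implicit Arguments.
Unset Strict Implicit.
Unset Printing Implicit Defensive.

Import Order.TTheory GRing.Theory.
Local Open Scope ring_scope.

Definition bot (k : 'Z_2) : P14 := inl k.
Definition pt (i : 'Z_4) (j : 'I_3) : P14 := inr (i, j).

Definition lvl0 : 'I_3 := inord 0.
Definition lvl1 : 'I_3 := inord 1.
Definition lvl2 : 'I_3 := inord 2.

Lemma lvlE (j : 'I_3) : [\/ j = lvl0, j = lvl1 | j = lvl2].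
Proof.
case: j => -[|[|[|//]]] ltj3; [apply: Or31 | apply: Or32 | apply: Or33];
  by apply/val_inj; rewrite /= inordK.
Qed.

Lemma P14_gen_le (x y : P14) : P14_gen x y -> (x <= y)%O.
Proof. exact: connect1. Qed.

Lemma le_bot_lvl0 k i : (bot k <= pt i lvl0)%O.
Proof. by apply: P14_gen_le; rewrite /= inordK. Qed.

Lemma le_lvl01 i : (pt i lvl0 <= pt i lvl1)%O.
Proof. by apply: P14_gen_le; rewrite /= !inordK // !eqxx ?orbT. Qed.

Lemma le_lvl12 i : (pt i lvl1 <= pt i lvl2)%O.
Proof. by apply: P14_gen_le; rewrite /= !inordK // !eqxx ?orbT. Qed.

Lemma le_lvl02_next i : (pt i lvl0 <= pt (i + 1) lvl2)%O.
Proof. by apply: P14_gen_le; rewrite /= !inordK // !eqxx !orbT. Qed.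

(** An invariant of paths of generating steps: a step inside a column keeps the
    index, and a step to the next column jumps from level 0 to level 2, so it
    can neither follow nor precede another step between levels. *)
Lemma le_pt (i i' : 'Z_4) (j j' : 'I_3) : (pt i j <= pt i' j')%O ->
  (i' == i) || [&& i' == i + 1, j == 0%N :> nat & j' == 2%N :> nat].
Proof.
case/connectP=> p; elim: p i j => [|[k|[i1 j1]] p IHp] i j.
- by move=> _ [->]; rewrite eqxx.
- by case: j.
case/andP=> /= step path_p last_p.
case/or3P: step => /and3P[/eqP i1E /eqP jE /eqP j1E];
  have := IHp _ _ path_p last_p; rewrite i1E j1E jE /= ?andbF ?orbF.
- by move=> ->.
- by move=> ->.
(* From level 2 only the empty path remains, as heights increase. *)
move=> /eqP ->; rewrite eqxx /=.
have := P14_le_height (introT connectP (ex_intro2 _ _ p path_p last_p)).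
case/orP=> [/eqP[_ <-]|]; first by rewrite j1E orbT.
by rewrite /= j1E; case: (j') => -[|[|[|]]].
Qed.

Lemma lt_height (x y : P14) : (x < y)%O -> (P14_height x < P14_height y)%N.
Proof.
rewrite lt_neqAle => /andP[neq_xy /P14_le_height].
by rewrite (negPf neq_xy).
Qed.

Lemma height_le3 (x : P14) : (P14_height x <= 3)%N.
Proof. by case: x => [k|[i j]] //=; apply: ltn_ord. Qed.

(** * Translations *)

Definition translate (x : P14) (u : 'Z_2 * 'Z_4) : P14 :=
  match x with
  | inl k => bot ((k : 'Z_2) + u.1)
  | inr (i, j) => pt (i + u.2) j
  end.

Lemma translate_is_action : is_action [set: 'Z_2 * 'Z_4] translate.
Proof.
apply: is_total_action => [[k|[i j]]|[k|[i j]] u v] /=.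
- by rewrite addr0.
- by rewrite addr0.
- by rewrite addrA.
- by rewrite addrA.
Qed.

Definition translation : {action ('Z_2 * 'Z_4)%type &-> P14} :=
  Action translate_is_action.

Lemma translate_homo u : {homo translate^~ u : x y / (x <= y)%O}.
Proof.
move=> x y /connectP[p]; elim: p x => [|z p IHp] x /=.
  by move=> _ ->.
case/andP=> gen_xz path_p last_p; apply: le_trans (IHp z path_p last_p).
apply: P14_gen_le; case: x z gen_xz {path_p last_p IHp} => [k|[i j]] [k'|[i' j']] //=.
by rewrite addrAC !(inj_eq (addIr _)).
Qed.

Lemma translation_aut u : actperm translation u \in poset_Aut P14.
Proof.
apply/poset_AutP; rewrite -morphV ?inE //; split=> x y le_xy;
  by rewrite !actpermE; apply: translate_homo.
Qed.

Lemma translation_inj : ('injm (actperm translation))%g.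
Proof.
apply/injmP=> -[u1 u2] [v1 v2] _ _ /permP eq_uv.
move: (eq_uv (bot 0)) (eq_uv (pt 0 lvl0)); rewrite !actpermE /=.
by rewrite !add0r => -[->] [->].
Qed.

(** * Rigidity *)

Section Rigidity.

Variable s : {perm P14}.
Hypothesis s_homo : {homo s : x y / (x <= y)%O}.

Lemma aut_lt x y : (x < y)%O -> (s x < s y)%O.
Proof.
by rewrite !lt_neqAle (inj_eq perm_inj) => /andP[-> /s_homo ->].
Qed.

(** The four heights along a chain meeting every height increase strictly and
    are at most 3, which leaves no choice. *)
Lemma aut_chain_height k i :
  [/\ P14_height (s (bot k)) = 0%N, P14_height (s (pt i lvl0)) = 1%N,
      P14_height (s (pt i lvl1)) = 2%N & P14_height (s (pt i lvl2)) = 3%N].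
Proof.
have lt_lvl j j' : j != j' -> (pt i j <= pt i j')%O ->
    (P14_height (s (pt i j)) < P14_height (s (pt i j')))%N.
  move=> neq_j le_j; apply/lt_height/aut_lt; rewrite lt_neqAle le_j andbT.
  by apply: contra neq_j => /eqP[->].
have: (P14_height (s (bot k)) < P14_height (s (pt i lvl0)))%N.
  by apply/lt_height/aut_lt; rewrite lt_neqAle le_bot_lvl0 andbT.
have: (P14_height (s (pt i lvl0)) < P14_height (s (pt i lvl1)))%N.
  by apply: lt_lvl (le_lvl01 i); rewrite -val_eqE /= !inordK.
have: (P14_height (s (pt i lvl1)) < P14_height (s (pt i lvl2)))%N.
  by apply: lt_lvl (le_lvl12 i); rewrite -val_eqE /= !inordK.
have := height_le3 (s (pt i lvl2)).
case: (P14_height (s (bot k))) => [|?];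
  case: (P14_height (s (pt i lvl0))) => [|[|?]] //;
  case: (P14_height (s (pt i lvl1))) => [|[|[|?]]] //;
  by case: (P14_height (s (pt i lvl2))) => [|[|[|[|?]]]].
Qed.

Lemma aut_height x : P14_height (s x) = P14_height x.
Proof.
case: x => [k|[i j]]; first by case: (aut_chain_height k 0).
case: (aut_chain_height 0 i) => _ h0 h1 h2.
by case: (lvlE j) => ->; rewrite /= inordK.
Qed.

(** The action on indices is read off on level 0; the default 0 is never reached
    when [s] is monotone, by [aut_height]. *)
Definition aut_index (i : 'Z_4) : 'Z_4 :=
  if s (pt i lvl0) is inr (i', _) then i' else 0.

Lemma aut_pt i j : exists i', s (pt i j) = pt i' j.
Proof.
have := aut_height (pt i j); case: (s _) => [k|[i' j']] //= [/val_inj->].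
by exists i'.
Qed.

Lemma aut_column i j : s (pt i j) = pt (aut_index i) j.
Proof.
have s0 : s (pt i lvl0) = pt (aut_index i) lvl0.
  by rewrite /aut_index; case: (aut_pt i lvl0) => i' ->.
have s1 : s (pt i lvl1) = pt (aut_index i) lvl1.
  have := s_homo (le_lvl01 i); rewrite s0; case: (aut_pt i lvl1) => i' ->.
  by move/le_pt; rewrite !inordK // !andbF orbF => /eqP->.
have s2 : s (pt i lvl2) = pt (aut_index i) lvl2.
  have := s_homo (le_lvl12 i); rewrite s1; case: (aut_pt i lvl2) => i' ->.
  by move/le_pt; rewrite !inordK // !andbF orbF => /eqP->.
by case: (lvlE j) => ->.
Qed.

Lemma aut_indexS i : aut_index (i + 1) = aut_index i + 1.
Proof.
have := s_homo (le_lvl02_next i); rewrite !aut_column => /le_pt/orP[/eqP eq_i|].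
  have /perm_inj[] : s (pt (i + 1) lvl0) = s (pt i lvl0).
    by rewrite !aut_column eq_i.
  by move/eqP; rewrite -subr_eq0 addrC addKr.
by case/and3P=> /eqP.
Qed.

Lemma aut_rotation i : aut_index i = i + aut_index 0.
Proof.
rewrite -(natr_Zp i); elim: (i : nat) => [|n IHn]; first by rewrite add0r.
by rewrite -natr1 aut_indexS IHn addrAC.
Qed.

End Rigidity.

Lemma I2_inj_translation (f : 'Z_2 -> 'Z_2) : injective f ->
  forall k, f k = k + f 0.
Proof.
move=> f_inj.
have neq10 : f 1 != f 0 by rewrite (inj_eq f_inj).
have f1 : f 1 = 1 + f 0.
  by move: neq10; case: (f 1) (f 0) => -[|[|//]] ? [[|[|//]] ?] // _; apply/val_inj.
case=> -[|[|//]] lt_k; set k := Ordinal lt_k.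
  by rewrite (_ : k = 0) ?add0r //; apply/val_inj.
by rewrite (_ : k = 1) //; apply/val_inj.
Qed.

Lemma aut_is_translation (s : {perm P14}) :
  {homo s : x y / (x <= y)%O} -> exists u, s = actperm translation u.
Proof.
move=> s_homo.
pose f (k : 'Z_2) : 'Z_2 := if s (bot k) is inl k' then k' else 0.
have sf k : s (bot k) = bot (f k).
  by rewrite /f; have := aut_height s_homo (bot k); case: (s _) => [|[]].
have f_inj : injective f.
  move=> k k' eq_f.
  by have /perm_inj[] : s (bot k) = s (bot k') by rewrite !sf eq_f.
exists (f 0, aut_index s 0); apply/permP=> -[k|[i j]]; rewrite actpermE /=.
  by rewrite sf (I2_inj_translation f_inj).
by rewrite (aut_column s_homo) (aut_rotation s_homo).
Qed.

Lemma translation_image :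
  (actperm translation @* [set: 'Z_2 * 'Z_4])%g = poset_Aut P14.
Proof.
apply/setP=> s; apply/morphimP/idP=> [[u _ _ ->]|/poset_AutP[s_homo _]].
  exact: translation_aut.
by have [u ->] := aut_is_translation s_homo; exists u; rewrite ?inE.
Qed.

Theorem theorem6p4 : (poset_Aut P14 \isog [set: 'Z_2 * 'Z_4])%g.
Proof.
rewrite isog_sym; have := sub_isog (subxx _) translation_inj.
by rewrite translation_image.
Qed.
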